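(* Let $g$ be a locally Lipschitz function on $\mathbb{R}$ and suppose there is a separately convex function $h$ on $\mathbb{R}^2$ such that $g(t)=h(t,t)$ for every $t\in\mathbb{R}$. Then for every bounded interval $I\subset\mathbb{R}$ there is a constant $C^*(g,I)$ such that $$-\int_0^1\frac{\omega^*_g(x,t)}{t^2}\,dt<C^*(g,I)$$ for every $x\in I$.
   Context: A function $h:\mathbb{R}^2\to\mathbb{R}$ is called separately convex if it is convex on every line parallel to a coordinate axis. For a real function $g$ on $\mathbb{R}$, $\omega_g(x,t):=g(x+t)+g(x-t)-2g(x)$, and for $t\ge0$, $\omega^*_g(x,\cdot)$ is defined as the greatest non-increasing minorant of $\omega_g(x,\cdot)$ on $[0,\infty)$. *)

(* Defs.v *)
From HB Require Import structures.
From mathcomp Require Import all_boot all_order all_algebra.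
From mathcomp Require Import all_classical all_reals all_analysis.
Set Implicit Arguments. Unset Strict Implicit. Unset Printing Implicit Defensive.
Import Order.TTheory GRing.Theory Num.Theory.
Local Open Scope ring_scope.
Local Open Scope classical_set_scope.

Definition convex_on_line (R : realType) (f : R -> R) : Prop :=
  forall (a b l : R), 0 <= l -> l <= 1 ->
    f ((1 - l) * a + l * b) <= (1 - l) * f a + l * f b.

Definition separately_convex (R : realType) (h : R -> R -> R) : Prop :=
  (forall y : R, convex_on_line (fun t => h t y)) /\
  (forall x : R, convex_on_line (fun t => h x t)).

Definition locally_lipschitz (R : realType) (g : R -> R) : Prop :=
  forall x : R, exists r : R, 0 < r /\ exists L : R,
    forall y z : R, `|y - x| < r -> `|z - x| < r ->
      `|g y - g z| <= L * `|y - z|.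

Definition omega (R : realType) (g : R -> R) (x t : R) : R :=
  g (x + t) + g (x - t) - 2 * g x.

Definition nonincr_minorant (R : realType) (g : R -> R) (x : R) (phi : R -> R) : Prop :=
  (forall s t : R, 0 <= s -> s <= t -> phi t <= phi s) /\
  (forall t : R, 0 <= t -> phi t <= omega g x t).

(* omega^*_g(x,t): the greatest non-increasing minorant of omega_g(x,.) on
   [0,oo), i.e. the pointwise supremum of all non-increasing minorants. *)
Definition omega_star (R : realType) (g : R -> R) (x t : R) : R :=
  sup [set phi t | phi in nonincr_minorant g x].

(* Main.v *)
(* Fix x and put A(t) = omega_g(x,t) and
   B(t) = h(x+t,x-t) + h(x-t,x+t) - 2 h(x,x).  Convexity on horizontal and
   vertical segments gives A + B >= 0 and, for 0 < t <= s,
     B(t)/t <= B(s)/s + (s-t)/(s+t) (A(t)/t + A(s)/s).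
   So B(t)/t is nondecreasing, nonnegative and bounded on {A <= 0}, and it
   increases by at least -A(s)/(3s) from t to s whenever 2t <= s.  Telescoping
   over dyadic scales bounds the sum over k of 2^k sup_{[0,2^-k]} (-A), which
   dominates the integral up to a factor 2, since -omega^* is the running
   supremum of -A. *)
Require Import Defs.
From HB Require Import structures.
From mathcomp Require Import all_boot all_order all_algebra.
From mathcomp Require Import all_classical all_reals all_analysis.
From mathcomp Require Import measurable_realfun ring lra.
Set Implicit Arguments. Unset Strict Implicit. Unset Printing Implicit Defensive.
Import Order.TTheory GRing.Theory Num.Theory.
Import numFieldNormedType.Exports.
Local Open Scope ring_scope.
Local Open Scope classical_set_scope.

(** * Chords of convex functions and boundedness on boxes *)

Lemma convex_chord (R : realType) (f : R -> R) (p q y : R) :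
  convex_on_line f -> p < q -> p <= y -> y <= q ->
  (q - p) * f y <= (q - y) * f p + (y - p) * f q.
Proof.
move=> cf pq py yq.
have qp0 : 0 < q - p by rewrite subr_gt0.
have /(cf p q) H : 0 <= (y - p) / (q - p) by rewrite divr_ge0 ?subr_ge0 ?(ltW pq).
have /H {}H : (y - p) / (q - p) <= 1 by rewrite ler_pdivrMr// mul1r lerD2r.
have E : (1 - (y - p) / (q - p)) * p + (y - p) / (q - p) * q = y.
  by field; rewrite gt_eqF.
rewrite E in H; apply: le_trans (ler_wpM2l (ltW qp0) H) _.
rewrite le_eqVlt; apply/orP; left; apply/eqP.
by field; rewrite gt_eqF.
Qed.

Lemma convex_le_ends (R : realType) (f : R -> R) (p q y : R) :
  convex_on_line f -> p < q -> p <= y -> y <= q -> f y <= `|f p| + `|f q|.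
Proof.
move=> cf pq py yq; have H := convex_chord cf pq py yq.
have qp0 : 0 < q - p by rewrite subr_gt0.
rewrite -(ler_pM2l qp0); apply: le_trans H _.
have := ler_norm (f p); have := ler_norm (f q).
have := normr_ge0 (f p); have := normr_ge0 (f q).
nra.
Qed.

Lemma convex_midpoint (R : realType) (f : R -> R) (c d : R) :
  convex_on_line f -> 2 * f c <= f (c + d) + f (c - d).
Proof.
move=> cf; have /(_ ltac:(lra) ltac:(lra)) := cf (c - d) (c + d) (2^-1).
have -> : (1 - 2^-1) * (c - d) + 2^-1 * (c + d) = c by field.
lra.
Qed.

(** Chords in both directions bound [h] above by the corner values. Midpoint inequalities through
    the centre [(c, c)] turn this into a lower bound: [4 * h c c] is at most [h y z] plus
    [3 * M]. *)
Lemma separately_convex_box_bound (R : realType) (h : R -> R -> R) (p q : R) :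
  separately_convex h -> p < q -> exists M : R, forall y z : R,
    p <= y -> y <= q -> p <= z -> z <= q -> `|h y z| <= M.
Proof.
move=> [h1 h2] pq.
pose M := `|h p p| + `|h p q| + (`|h q p| + `|h q q|).
have ubM y z : p <= y -> y <= q -> p <= z -> z <= q -> h y z <= M.
  move=> py yq pz zq.
  have bnd w : h y w <= `|h p w| + `|h q w| := convex_le_ends (h1 w) pq py yq.
  have H1 := convex_chord (h2 y) pq pz zq.
  have qp0 : 0 < q - p by rewrite subr_gt0.
  rewrite -(ler_pM2l qp0); apply: le_trans H1 _; rewrite /M.
  have := bnd p; have := bnd q.
  have := normr_ge0 (h p p); have := normr_ge0 (h q q).
  have := normr_ge0 (h p q); have := normr_ge0 (h q p).
  nra.
pose c := (p + q) / 2.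
exists (M + `|4 * h c c - 3 * M|) => y z py yq pz zq.
have M0 : 0 <= M by rewrite /M !addr_ge0.
have U : h y z <= M by exact: ubM.
have L : 4 * h c c - 3 * M <= h y z.
  have [cl cr] : p <= c /\ c <= q by rewrite /c; split; lra.
  have := convex_midpoint c (c - y) (h1 z); have := convex_midpoint c (z - c) (h2 c).
  have -> : c - (c - y) = y by lra.
  have -> : c + (z - c) = z by lra.
  have : h (c + (c - y)) z <= M by apply: ubM => //; rewrite /c; lra.
  have : h c (c - (z - c)) <= M by apply: ubM => //; rewrite /c; lra.
  lra.
rewrite ler_norml; apply/andP; split.
  have := ler_norm (- (4 * h c c - 3 * M)); rewrite normrN; lra.
by have := normr_ge0 (4 * h c c - 3 * M); lra.
Qed.

(** * Diagonal against antidiagonal second differences *)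

(** The second difference of [h] at [(x, x)] along the antidiagonal; [omega] of [fun u => h u u] is
    the one along the diagonal. *)
Definition omega_anti (R : realType) (h : R -> R -> R) (x t : R) : R :=
  h (x + t) (x - t) + h (x - t) (x + t) - 2 * h x x.

(** The two second differences add up to the corner values of a square minus four times the value at
    its centre. Convexity on the vertical sides, then between their midpoints, makes this
    nonnegative. *)
Lemma omega_anti_ge (R : realType) (h : R -> R -> R) (x t : R) :
  separately_convex h -> - omega (fun u => h u u) x t <= omega_anti h x t.
Proof.
move=> [h1 h2]; rewrite /omega /omega_anti.
have := convex_midpoint x t (h1 x).
have := convex_midpoint x t (h2 (x + t)); have := convex_midpoint x t (h2 (x - t)).
lra.
Qed.

(* The laminate behind this: (x + t, x - t) lies on the vertical segment from
   (x + t, x + t) to (x + t, x - s), whose lower end lies on the horizontal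
   segment from (x - s, x - s) to (x + s, x - s); likewise for (x - t, x + t). *)
Lemma omega_anti_ratio_le (R : realType) (h : R -> R -> R) (x t s : R) :
  separately_convex h -> 0 < t -> t <= s ->
  omega_anti h x t / t <= omega_anti h x s / s + (s - t) / (s + t) *
    (omega (fun u => h u u) x t / t + omega (fun u => h u u) x s / s).
Proof.
move=> [h1 h2] t0 ts; have s0 : 0 < s by lra.
set A := omega _ x; set B := omega_anti h x.
have key : s * (s + t) * B t <=
    s * (s - t) * A t + t * (s - t) * A s + t * (s + t) * B s.
  rewrite /A /B /omega /omega_anti.
  have a1 : x - s < x + t by lra.
  have a2 : x - t < x + s by lra.
  have a3 : x - s < x + s by lra.
  have := convex_chord (h2 (x + t)) a1 (y := x - t) ltac:(lra) ltac:(lra).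
  have := convex_chord (h1 (x - s)) a3 (y := x + t) ltac:(lra) ltac:(lra).
  have := convex_chord (h2 (x - t)) a2 (y := x + t) ltac:(lra) ltac:(lra).
  have := convex_chord (h1 (x + s)) a3 (y := x - t) ltac:(lra) ltac:(lra).
  (* Weights [t] on horizontal and [s] on vertical chords cancel the values at the auxiliary points
     [(x + t, x - s)] and [(x - t, x + s)]. *)
  move=> /(ler_wpM2l (ltW t0)) e1 /(ler_wpM2l (ltW s0)) e2.
  move=> /(ler_wpM2l (ltW t0)) e3 /(ler_wpM2l (ltW s0)) e4.
  lra.
have P : 0 < t * s * (s + t) by rewrite !mulr_gt0 ?addr_gt0.
rewrite -(ler_pM2l P).
have -> : t * s * (s + t) * (B t / t) = s * (s + t) * B t by field; rewrite gt_eqF.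
have -> : t * s * (s + t) * (B s / s + (s - t) / (s + t) * (A t / t + A s / s)) =
   s * (s - t) * A t + t * (s - t) * A s + t * (s + t) * B s.
  by field; rewrite !gt_eqF ?addr_gt0.
exact: key.
Qed.

(** * Running suprema and [omega_star] *)

Definition running_sup (R : realType) (f : R -> R) (t : R) : R :=
  sup [set f s | s in [set s | 0 <= s /\ s <= t]].

Lemma running_sup_ub (R : realType) (f : R -> R) (t s : R) :
  (exists M : R, forall u : R, 0 <= u -> u <= t -> f u <= M) ->
  0 <= s -> s <= t -> f s <= running_sup f t.
Proof.
move=> [M fM] s0 st; apply: ub_le_sup; last by exists s.
by exists M => _ [u [u0 ut] <-]; exact: fM.
Qed.

Lemma running_sup_le (R : realType) (f : R -> R) (t c : R) :
  0 <= t -> (forall s : R, 0 <= s -> s <= t -> f s <= c) ->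
  running_sup f t <= c.
Proof.
move=> t0 fc; apply: ge_sup; first by exists (f 0); exists 0.
by move=> _ [s [s0 st] <-]; exact: fc.
Qed.

(* For t < 0 the supremum is over the empty set, hence 0; this makes the
   monotonicity global when f 0 = 0. *)
Lemma running_sup_neg (R : realType) (f : R -> R) (t : R) :
  t < 0 -> running_sup f t = 0.
Proof.
move=> t0; rewrite /running_sup; set S := [set f s | s in _].
have -> : S = set0; last exact: sup0.
apply/seteqP; split=> // y [s [s0 st] _].
by move: (le_lt_trans (le_trans s0 st) t0); rewrite ltxx.
Qed.

Lemma running_sup_ge0 (R : realType) (f : R -> R) (t : R) : f 0 = 0 ->
  (exists M : R, forall u : R, 0 <= u -> u <= t -> f u <= M) ->
  0 <= running_sup f t.
Proof.
move=> f0 bf; have [t0|t0] := ltP t 0; first by rewrite running_sup_neg.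
by have := running_sup_ub bf (lexx 0) t0; rewrite f0.
Qed.

Lemma running_sup_nondecreasing (R : realType) (f : R -> R) : f 0 = 0 ->
  (forall t : R, exists M : R, forall u : R, 0 <= u -> u <= t -> f u <= M) ->
  {homo running_sup f : s t / s <= t}.
Proof.
move=> f0 bf s t st; have [s0|s0] := ltP s 0.
  by rewrite (running_sup_neg _ s0) running_sup_ge0.
apply: running_sup_le => // u u0 us.
by apply: running_sup_ub => //; exact: le_trans st.
Qed.

(** [- m] is a non-increasing minorant, and any other [phi] lies below it since
    [phi t <= phi s <= omega g x s] for [0 <= s <= t]. The bound on [- omega] keeps [sup] from
    taking its default value. *)
Lemma omega_starE (R : realType) (g : R -> R) (x t : R) : 0 <= t ->
  (forall r : R, exists M : R, forall u : R,
    0 <= u -> u <= r -> - omega g x u <= M) ->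
  omega_star g x t = - running_sup (fun s => - omega g x s) t.
Proof.
move=> t0 bf; set m := running_sup _.
have m_minorant : nonincr_minorant g x (fun u => - m u).
  split=> [s u s0 su|u u0]; last first.
    by rewrite lerNl; exact: (@running_sup_ub _ (fun s => - omega g x s)).
  rewrite lerN2; apply: running_sup_le => // v v0 vs.
  by apply: (@running_sup_ub _ (fun s => - omega g x s)) => //; exact: le_trans su.
have le_star phi : nonincr_minorant g x phi -> phi t <= - m t.
  move=> [phi_ni phi_le]; rewrite lerNr; apply: running_sup_le => // s s0 st.
  by rewrite lerN2; exact: le_trans (phi_ni _ _ s0 st) (phi_le _ s0).
apply/eqP; rewrite eq_le; apply/andP; split.
  apply: ge_sup; first by exists (- m t); exists (fun u => - m u).
  by move=> _ [phi /le_star ? <-].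
apply: ub_le_sup; last by exists (fun u => - m u).
by exists (- m t) => _ [phi /le_star ? <-].
Qed.

(** * Telescoping over dyadic scales *)

(* P plays the role of omega_anti / t: it is nondecreasing on {A <= 0}, with
   jumps that control - A.  Extending it to a nondecreasing function V on all
   of ]0, 1] and telescoping V over dyadic scales gives the bound. *)
Lemma dyadic_sum_running_sup (R : realType) (A P : R -> R) (K : R) (N : nat) :
  A 0 = 0 -> 0 <= K ->
  (forall s : R, 0 < s -> s <= 1 -> A s <= 0 -> - A s <= s * P s) ->
  (forall s : R, 0 < s -> s <= 1 -> A s <= 0 -> P s <= K) ->
  (forall t s : R, 0 < t -> t <= s -> s <= 1 -> A t <= 0 -> A s <= 0 ->
    P t <= P s) ->
  (forall t s : R, 0 < t -> 2 * t <= s -> s <= 1 -> A t <= 0 -> A s <= 0 ->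
    - A s <= 3 * s * (P s - P t)) ->
  \sum_(k < N) running_sup (fun s => - A s) (2^-1 ^+ k) / 2^-1 ^+ k <= 13 * K.
Proof.
move=> A0 K0 AP PK Pmono Pjump.
set m := running_sup _.
(* Adjoining 0 keeps [D t] nonempty even if [A > 0] on all of []0, t]], and makes [V]
   nonnegative. *)
pose D t := [set y : R | y = 0 \/
  exists s : R, [/\ 0 < s, s <= t, A s <= 0 & y = P s]].
pose V t := sup (D t).
have Dub t : t <= 1 -> ubound (D t) K.
  move=> t1 _ [->//|[s [s0 st As ->]]].
  by apply: PK => //; exact: le_trans t1.
have hubD t : t <= 1 -> has_ubound (D t) by exists K; exact: Dub.
have nD t : D t !=set0 by exists 0; left.
have V_ge0 t : t <= 1 -> 0 <= V t.
  by move=> t1; apply: ub_le_sup; [exact: hubD|left].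
have V_le t : t <= 1 -> V t <= K by move=> t1; apply: ge_sup => //; exact: Dub.
have V_mono s t : s <= t -> t <= 1 -> V s <= V t.
  move=> st t1; apply: ge_sup => // _ [->|[u [u0 us Au ->]]]; first exact: V_ge0.
  apply: ub_le_sup; first exact: hubD.
  by right; exists u; split => //; exact: le_trans st.
have P_le s : 0 < s -> s <= 1 -> A s <= 0 -> P s <= V s.
  move=> s0 s1 As; apply: ub_le_sup; first exact: hubD.
  by right; exists s; split.
(* By [Pjump], each [P t] with [t <= s / 2] is at most [P s + A s / (3 * s)]; by [AP], so is the
   adjoined 0. Hence so is [V (s / 2)]. *)
have V_jump s : 0 < s -> s <= 1 -> A s <= 0 -> - A s <= 3 * s * (V s - V (s / 2)).
  move=> s0 s1 As.
  have H : V (s / 2) <= P s - - A s / (3 * s).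
    apply: ge_sup => // _ [->|[t [t0 ts At ->]]].
      rewrite subr_ge0 ler_pdivrMr ?mulr_gt0//.
      have := AP _ s0 s1 As; nra.
    rewrite lerBrDl -lerBrDr ler_pdivrMr ?mulr_gt0//.
    have /(_ ltac:(lra)) := Pjump t s t0 _ s1 At As; lra.
  have : - A s = 3 * s * (P s - (P s - - A s / (3 * s))).
    by field; rewrite gt_eqF.
  move=> ->; apply: ler_wpM2l; first lra.
  by apply: lerB => //; exact: P_le.
pose d (k : nat) : R := 2^-1 ^+ k.
have d0 k : 0 < d k by rewrite exprn_gt0.
have d1 k : d k <= 1 by rewrite exprn_ile1//; lra.
have dS k : d k.+1 = d k / 2 by rewrite /d exprSr.
have A_le s : 0 <= s -> s <= 1 -> - A s <= K * s.
  rewrite le_eqVlt => /predU1P[<- _|s0 s1]; first by rewrite A0; lra.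
  have [As|/ltW As] := leP (A s) 0; last by nra.
  have := AP _ s0 s1 As; have := PK _ s0 s1 As; nra.
have bA t : t <= 1 ->
    exists M : R, forall u : R, 0 <= u -> u <= t -> - A u <= M.
  move=> t1; exists K => u u0 ut; have := A_le u u0 (le_trans ut t1).
  have : u <= 1 by exact: le_trans t1.
  nra.
have m_ge0 k : 0 <= m (d k).
  by apply: running_sup_ge0; [rewrite A0 oppr0|exact: bA].
have m_le k : m (d k) <= K * d k.
  apply: running_sup_le; first exact: ltW.
  move=> s s0 sd; apply: le_trans (A_le _ s0 (le_trans sd (d1 k))) _.
  exact: ler_wpM2l.
(* Points up to [d k.+1] are covered by [m (d k.+1)]. For the others [s / 2] exceeds [d k.+2], so
   the jump of [V] spans two dyadic steps. *)
have m_rec k : m (d k) <= 3 * d k * (V (d k) - V (d k.+2)) + m (d k.+1).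
  have VV : 0 <= 3 * d k * (V (d k) - V (d k.+2)).
    apply: mulr_ge0; first by have := d0 k; lra.
    by rewrite subr_ge0 V_mono// !dS; have := d0 k; lra.
  apply: running_sup_le; first exact: ltW.
  move=> s s0 sd; have [sle|slt] := leP s (d k.+1).
    rewrite -[leLHS]add0r; apply: lerD => //.
    by apply: (@running_sup_ub _ (fun s => - A s)) => //; exact: bA.
  have {}s0 : 0 < s by exact: lt_trans slt.
  have s1 : s <= 1 by exact: le_trans (d1 k).
  have [As|As] := leP (A s) 0; last by have := m_ge0 k.+1; lra.
  apply: ler_wpDr => //; apply: le_trans (V_jump s s0 s1 As) _.
  have Vs : V s <= V (d k) by exact: V_mono.
  have Vs2 : V (d k.+2) <= V (s / 2) by apply: V_mono; rewrite ?(dS k.+1); lra.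
  have Vss : V (s / 2) <= V s by apply: V_mono => //; lra.
  nra.
pose E k := m (d k) / d k.
(* Dividing [m_rec] by [d k] halves the term [E k.+1]; doubling and moving one [E k] to the right
   leaves a telescoping bound. *)
have E_rec k : E k <= 6 * (V (d k) - V (d k.+2)) + E k.+1 - E k.
  have : E k <= 3 * (V (d k) - V (d k.+2)) + E k.+1 / 2.
    rewrite /E ler_pdivrMr// mulrDl.
    have -> : m (d k.+1) / d k.+1 / 2 * d k = m (d k.+1).
      by rewrite dS; field; rewrite gt_eqF.
    have := m_rec k; lra.
  lra.
have sumE n : \sum_(k < n) E k <=
    6 * (V (d 0) + V (d 1) - V (d n) - V (d n.+1)) + E n - E 0.
  elim: n => [|n IH]; first by rewrite big_ord0; lra.
  rewrite big_ord_recr/=; have := E_rec n; lra.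
(* 13 = 6 * 2 + 1: two values of [V] and one of [E], each at most [K]. *)
apply: le_trans (sumE N) _.
have E_le : E N <= K by rewrite /E ler_pdivrMr.
have E0 : 0 <= E 0 by rewrite /E divr_ge0// ltW.
have := V_le (d 0) (d1 0); have := V_le (d 1) (d1 1).
have := V_ge0 (d N) (d1 N); have := V_ge0 (d N.+1) (d1 N.+1).
lra.
Qed.

(** * From dyadic sums to the integral *)

Lemma measurable_inv_sqr (R : realType) (D : set R) :
  measurable D -> (forall t : R, D t -> 0 < t) ->
  measurable_fun D (fun t : R => (t ^+ 2)^-1).
Proof.
move=> mD D0; apply: (@eq_measurable_fun _ _ _ _ _ (fun t : R => t `^ (- 2))).
  by move=> t; rewrite inE => /D0 t0; rewrite powRN powR_mulrn// ltW.
by apply: measurable_funTS; exact: measurable_powR.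
Qed.

(** On []d k.+1, d k]], of length [d k / 2], the integrand is at most [m (d k) / d k.+1 ^+ 2], which
    contributes [2 * (m (d k) / d k)]. Monotone convergence along []d n, 1]] then reaches 0. *)
Lemma integral_dyadic_bound (R : realType) (m : R -> R) (K : R) :
  {homo m : s t / s <= t} -> (forall t : R, 0 <= m t) ->
  (forall N : nat, \sum_(k < N) m (2^-1 ^+ k) / 2^-1 ^+ k <= K) ->
  (\int[lebesgue_measure]_(t in `]0%R, 1%R]) (m t / t ^+ 2)%:E
     <= (2 * K)%:E)%E.
Proof.
move=> m_mono m_ge0 sumK.
pose d (k : nat) : R := 2^-1 ^+ k.
have d0 k : 0 < d k by rewrite exprn_gt0.
have d1 k : d k <= 1 by rewrite exprn_ile1//; lra.
have dS k : d k.+1 = d k / 2 by rewrite /d exprSr.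
pose f (t : R) : \bar R := (m t / t ^+ 2)%:E.
have f_ge0 t : (0 <= f t)%E by rewrite lee_fin divr_ge0// sqr_ge0.
have mf (D : set R) : measurable D -> (forall t : R, D t -> 0 < t) ->
    measurable_fun D f.
  move=> mD D0; apply/measurable_EFinP; apply: measurable_funM.
    exact: nondecreasing_measurable.
  exact: measurable_inv_sqr.
have pos a b : 0 <= a -> forall t, `]a, b]%classic t -> 0 < t :> R.
  by move=> a0 t /=; rewrite in_itv/= => /andP[/(le_lt_trans a0)].
pose F k : set R := `]d k, 1]%classic.
have -> : `]0%R, 1%R]%classic = \bigcup_k F k.
  apply/seteqP; split=> [t /=|t [k _]]; last first.
    rewrite /F /= !in_itv/= => /andP[dt ->]; rewrite andbT.
    exact: lt_trans dt.
  rewrite in_itv/= => /andP[t0 t1].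
  have : d k @[k --> \oo] --> (0 : R).
    by apply: cvg_expr; rewrite ger0_norm; lra.
  move=> /cvgrPdist_lt /(_ _ t0)[k _ /(_ _ (leqnn k))].
  rewrite sub0r normrN gtr0_norm// => dt; exists k => //.
  by rewrite /F /= in_itv/= dt.
have step k : (\int[lebesgue_measure]_(t in `]d k.+1, d k]) f t
    <= (2 * (m (d k) / d k))%:E)%E.
  apply: (@le_trans _ _ (\int[lebesgue_measure]_(t in `]d k.+1, d k])
      (cst (m (d k) / d k.+1 ^+ 2)%:E) t)%E).
    apply: ge0_le_integral => //.
    - by apply: mf => //; apply: pos; exact: ltW.
    - move=> t /=; rewrite in_itv/= => /andP[dt td]; rewrite lee_fin.
      apply: ler_pM => //; first by rewrite invr_ge0 sqr_ge0.
        exact: m_mono.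
      have t0 : 0 < t by exact: lt_trans dt.
      rewrite lef_pV2 ?posrE ?exprn_gt0// lerXn2r ?nnegrE ?ltW//.
  rewrite integral_cst//= lebesgue_measure_itv/= lte_fin.
  rewrite dS ifT; last by have := d0 k; lra.
  rewrite -EFinD -EFinM lee_fin le_eqVlt; apply/orP; left; apply/eqP.
  by field; rewrite gt_eqF.
have partial n : (\int[lebesgue_measure]_(t in F n) f t
    <= (2 * \sum_(k < n) m (d k) / d k)%:E)%E.
  elim: n => [|n IH].
    by rewrite /F /d expr0 set_itvoc0 integral_set0 big_ord0 mulr0.
  have -> : F n.+1 = `]d n.+1, d n]%classic `|` F n.
    rewrite /F -itv_bndbnd_setU// bnd_simp ?d1// dS.
    by have := d0 n; lra.
  rewrite ge0_integral_setU//; last 3 first.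
  - exact: measurable_itv.
  - apply: mf; first by apply: measurableU; exact: measurable_itv.
    by move=> t [] /pos; apply; exact: ltW.
  - apply/disj_set2P/seteqP; split => // t [] /=.
    rewrite /F /= !in_itv/= => /andP[_ td] /andP[dt _].
    by move: (le_lt_trans td dt); rewrite ltxx.
  rewrite big_ord_recr/= mulrDr EFinD addeC; exact: leeD.
have cvgF : (\int[lebesgue_measure]_(t in F i) f t)%E
    @[i --> \oo] --> (\int[lebesgue_measure]_(t in \bigcup_i F i) f t)%E.
  apply: ge0_nondecreasing_set_cvg_integral => //.
  - move=> i j ij; apply/subsetPset => t; rewrite /F /= !in_itv/= => /andP[dt ->].
    rewrite andbT; apply: le_lt_trans dt.
    by apply: ler_wiXn2l => //; lra.
  - by move=> i; exact: measurable_itv.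
  - by move=> i; apply: mf; [exact: measurable_itv|apply: pos; exact: ltW].
rewrite -(cvg_lim _ cvgF)//; apply: lime_le.
  by apply/cvg_ex; eexists; exact: cvgF.
near=> n; apply: le_trans (partial n) _.
by rewrite lee_fin ler_pM2l// sumK.
Unshelve. all: by end_near. Qed.

(** * Constants uniform in the base point *)

Theorem theorem4p2 (R : realType) (g : R -> R) :
  locally_lipschitz g ->
  (exists h : R -> R -> R, separately_convex h /\ forall t : R, g t = h t t) ->
  forall a b : R, exists C : R, forall x : R, a <= x -> x <= b ->
    (\int[lebesgue_measure]_(t in `]0%R, 1%R]) ((- omega_star g x t) / t ^+ 2)%:E
       < C%:E)%E.
Proof.
move=> _ [h [sc gh]] a b; have {gh}-> : g = (fun t => h t t) by apply/funext.
have [ab|ba] := leP a b; last first.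
  by exists 0 => x ax xb; move: (lt_le_trans ba (le_trans ax xb)); rewrite ltxx.
(* The margin 1 contains every [x + t] and [x - t] with [t <= 1], so [M] is independent of [x]. *)
have [M hM] : exists M : R, forall y z : R, a - 1 <= y -> y <= b + 1 ->
    a - 1 <= z -> z <= b + 1 -> `|h y z| <= M.
  by apply: separately_convex_box_bound => //; lra.
(* Here [8 * M] bounds [B 1 + |A 1|], 13 comes from the dyadic sum, 2 from the integral, and 1 makes
   the inequality strict. *)
exists (2 * (13 * (8 * M)) + 1) => x ax xb.
set A := omega (fun u => h u u) x; pose B := omega_anti h x.
have M0 : 0 <= M by apply: le_trans (normr_ge0 _) (hM a a _ _ _ _); lra.
have A0 : A 0 = 0 by rewrite /A /omega addr0 subr0; lra.
have AB t : - A t <= B t by exact: omega_anti_ge.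
(* Every radius [t] is allowed, so the box depends on [x] and [t]; this bound only makes the suprema
   finite and does not enter the constant. *)
have bA t : exists M : R, forall u : R, 0 <= u -> u <= t -> - A u <= M.
  have [t0|t0] := ltP t 0.
    by exists 0 => u u0 ut; move: (le_lt_trans (le_trans u0 ut) t0); rewrite ltxx.
  have [L hL] : exists L : R, forall y z : R, x - t - 1 <= y -> y <= x + t + 1 ->
      x - t - 1 <= z -> z <= x + t + 1 -> `|h y z| <= L.
    by apply: separately_convex_box_bound => //; lra.
  exists (4 * L) => u u0 ut; rewrite /A /omega.
  have [] := ler_normlP (h (x + u) (x + u)) L (hL _ _ _ _ _ _); try lra.
  have [] := ler_normlP (h (x - u) (x - u)) L (hL _ _ _ _ _ _); try lra.
  have [] := ler_normlP (h x x) L (hL _ _ _ _ _ _); lra.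
have P_le t s : 0 < t -> t <= s -> B t / t <= B s / s +
    (s - t) / (s + t) * (A t / t + A s / s) by exact: omega_anti_ratio_le.
have AB1 : B 1 + `|A 1| <= 8 * M.
  have bd y z : a - 1 <= y -> y <= b + 1 -> a - 1 <= z -> z <= b + 1 ->
      - M <= h y z /\ h y z <= M.
    by move=> *; apply/andP; rewrite -ler_norml; exact: hM.
  have [||||p1 q1] := bd x x; try lra.
  have [||||p2 q2] := bd (x + 1) (x + 1); try lra.
  have [||||p3 q3] := bd (x - 1) (x - 1); try lra.
  have [||||p4 q4] := bd (x + 1) (x - 1); try lra.
  have [||||p5 q5] := bd (x - 1) (x + 1); try lra.
  have : `|A 1| <= 4 * M by rewrite ler_norml /A /omega; apply/andP; split; lra.
  rewrite /B /omega_anti; lra.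
apply: (@le_lt_trans _ _ (2 * (13 * (8 * M)))%:E); last by rewrite lte_fin; lra.
set m := running_sup (fun s => - A s).
have -> : (\int[lebesgue_measure]_(t in `]0%R, 1%R])
      ((- omega_star (fun u => h u u) x t) / t ^+ 2)%:E =
    \int[lebesgue_measure]_(t in `]0%R, 1%R]) (m t / t ^+ 2)%:E)%E.
  apply: eq_integral => t; rewrite inE/= in_itv/= => /andP[/ltW t0 _].
  by rewrite omega_starE// opprK.
apply: integral_dyadic_bound.
- by apply: running_sup_nondecreasing => //; rewrite A0 oppr0.
- by move=> t; apply: running_sup_ge0 => //; rewrite A0 oppr0.
move=> N; apply: (dyadic_sum_running_sup (P := fun t => B t / t)) => //.
- by rewrite mulr_ge0.
- by move=> s s0 s1 As; rewrite mulrC divfK ?gt_eqF.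
(* Comparing with scale 1: the weight lies in [[0, 1]] and [A s / s <= 0], so only [B 1] and [|A 1|]
   remain. *)
- move=> s s0 s1 As; apply: le_trans (P_le s 1 s0 s1) _; rewrite !divr1.
  apply: le_trans AB1; rewrite lerD2l.
  have r0 : 0 <= (1 - s) / (1 + s) by rewrite divr_ge0//; lra.
  have r1 : (1 - s) / (1 + s) <= 1 by rewrite ler_pdivrMr; lra.
  have : A s / s <= 0 by rewrite ler_pdivrMr// mul0r.
  have := ler_norm (A 1); have := normr_ge0 (A 1); nra.
- move=> t s t0 ts s1 At As; apply: le_trans (P_le t s t0 ts) _.
  rewrite gerDl; apply: mulr_ge0_le0; first by rewrite divr_ge0; lra.
  by rewrite -[leRHS]addr0; apply: lerD; rewrite ler_pdivrMr ?mul0r//; lra.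
- move=> t s t0 ts s1 At As.
  have s0 : 0 < s by lra.
  have H := P_le t s t0 ltac:(lra).
  (* From [2 * t <= s] the numerator is at least [s / 2] and the denominator at most [3 * s / 2]. *)
  have r3 : 3^-1 <= (s - t) / (s + t) by rewrite ler_pdivlMr; lra.
  have : A t / t <= 0 by rewrite ler_pdivrMr ?mul0r.
  have E : A s = s * (A s / s) by field; rewrite gt_eqF.
  have As' : A s / s <= 0 by rewrite ler_pdivrMr ?mul0r.
  move=> At'.
  have : - (A s / s) <= 3 * (B s / s - B t / t) by nra.
  move=> /(ler_wpM2l (ltW s0)); rewrite mulrN -E; lra.
Qed.
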